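(* Let $\mathbb{Z}\curvearrowright(X,\mu)$ be an mcp (measure-class preserving) Borel action on a standard probability space $(X,\mu)$. Then the action is chaining if and only if it is totally ergodic.
   Context: $\mathbb{N}$ includes $0$. An action of a countable group $\Gamma$ (here $\Gamma=\mathbb{Z}$) is mcp if for all Borel $A\subseteq X$ and $\gamma\in\Gamma$, $\mu(A)=0$ iff $\mu(\gamma A)=0$. It is ergodic if every invariant $\mu$-measurable set is null or conull; it is totally ergodic if every infinite subgroup of $\Gamma$ acts ergodically. For $k\in\mathbb{N}$, $A$ $k$-chains to $B$ if there are $\gamma_0=1_\Gamma,\gamma_1,\dots,\gamma_k\in\Gamma$ with $\mu(\gamma_iA\cap\gamma_{i+1}A)>0$ for each $0\le i<k$ and $\mu(\gamma_kA\cap B)>0$. The action is chaining if for all sets $A,B\subseteq X$ of positive measure there is $\ell\in\mathbb{N}$ such that $A$ $\ell$-chains to $B$. *)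

(* Defs.v *)
From HB Require Import structures.
From mathcomp Require Import all_boot all_order all_algebra.
From mathcomp Require Import all_classical all_reals all_analysis.
From mathcomp Require Import measurable_realfun.

Set Implicit Arguments.
Unset Strict Implicit.
Unset Printing Implicit Defensive.

Import Order.TTheory GRing.Theory Num.Theory.
Local Open Scope classical_set_scope.
Local Open Scope ring_scope.

(* Complete and separable; a Hausdorff pseudometric is a metric. *)
Definition polish (R : realType) (T : completePseudoMetricType R) : Prop :=
  hausdorff_space T /\ exists2 S : set T, countable S & dense S.

Definition standard_borel (R : realType) (d : measure_display)
    (X : measurableType d) : Prop :=
  exists T : completePseudoMetricType R, polish T /\
  exists2 f : X -> T, bijective f &
    d.-measurable = [set f @^-1` B | B in <<s @open T>>].

Section IntegerActions.
Context (R : realType) (d : measure_display) (X : measurableType d).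
Implicit Types (mu : {measure set X -> \bar R}) (a : int -> X -> X).
Implicit Types (A B : set X) (H : set int).

(* As int is countable and discrete, (n, x) |-> a n x is Borel iff every
   a n is. *)
Definition borel_action a : Prop :=
  [/\ forall x, a 0 x = x,
      forall m n x, a (m + n) x = a m (a n x)
    & forall n, measurable_fun setT (a n)].

Definition mcp mu a : Prop :=
  forall A n, measurable A -> (mu A = 0%E <-> mu (a n @` A) = 0%E).

(* Measurability for the completion of mu: a measurable set up to a negligible
   one. For a measure on a sigma-algebra, the library's generator is already
   the completed sigma-algebra. *)
Definition mu_measurable mu A : Prop := completed_algebra_gen mu A.

Definition null mu A : Prop := mu.-negligible A.
Definition conull mu A : Prop := mu.-negligible (~` A).

(* On mu-measurable sets the outer measure mu^* is the completion of mu, and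
   on Borel sets it is mu. *)
Definition positive mu A : Prop := (0 < mu^*%mu A)%E.

Definition subgroup H : Prop := zmod_closed [in H].

Definition invariant_set a H A : Prop := forall n, H n -> a n @` A = A.

Definition ergodic_on mu a H : Prop :=
  forall A, mu_measurable mu A -> invariant_set a H A -> null mu A \/ conull mu A.

Definition totally_ergodic mu a : Prop :=
  forall H, subgroup H -> infinite_set H -> ergodic_on mu a H.

Definition chains_to mu a (k : nat) A B : Prop :=
  exists g : nat -> int,
    [/\ g 0%N = 0,
        forall i, (i < k)%N -> positive mu (a (g i) @` A `&` a (g i.+1) @` A)
      & positive mu (a (g k) @` A `&` B)].

Definition chaining mu a : Prop :=
  forall A B, mu_measurable mu A -> mu_measurable mu B ->
    positive mu A -> positive mu B -> exists l : nat, chains_to mu a l A B.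

End IntegerActions.

(* Main.v *)
(** [A] chains to [B] exactly when [n A] meets [B] in positive measure for some
  [n] in the subgroup [H] generated by the [m] with [mu (A `&` m A) > 0]; if [H]
  is infinite and acts ergodically, [H A] is conull, hence meets every set of
  positive measure. [H] is not trivial: [2Z A] is conull and so meets [1 A].
  Conversely, a set [B] invariant under [m Z] has finitely many translates, and
  an atom [A] of the finite algebra they generate is mapped by each [n] onto
  itself or off itself, so that it chains to nothing outside itself. *)
Require Import Defs.
From HB Require Import structures.
From mathcomp Require Import all_boot all_order all_algebra.
From mathcomp Require Import all_classical all_reals all_analysis.

Set Implicit Arguments.
Unset Strict Implicit.
Unset Printing Implicit Defensive.

Import Order.TTheory GRing.Theory Num.Theory.
Local Open Scope classical_set_scope.
Local Open Scope ring_scope.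

(** * Subgroups of the integers *)

Section Subgroups.
Implicit Types (H : set int).

Lemma subgroupP H :
  subgroup H <-> H 0 /\ forall x y, H x -> H y -> H (x - y).
Proof.
split=> [[H0 HB]|[H0 HB]].
  by split=> [|x y Hx Hy]; [have := H0 | have := HB x y]; rewrite !inE //; apply.
by split=> [|x y]; rewrite !inE //; exact: HB.
Qed.

Lemma subgroup_mul H h k : subgroup H -> H h -> H (h * k).
Proof.
move=> /subgroupP[H0 HB] Hh.
have HN x : H x -> H (- x) by move=> Hx; rewrite -sub0r; exact: HB.
have Hn (n : nat) : H (h * n%:Z).
  elim: n => [|n IHn]; first by rewrite mulr0.
  by rewrite intS mulrDr mulr1 addrC -[X in _ + X]opprK; apply: HB => //; exact: HN.
by case: k => n //; rewrite NegzE mulrN; exact: HN.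
Qed.

Lemma infinite_subgroup H h : subgroup H -> H h -> h != 0 -> infinite_set H.
Proof.
move=> sH Hh h0 finH.
have : finite_set ((fun n : nat => h * n%:Z) @^-1` H).
  by apply: finite_preimage finH => m n _ _ /(mulfI h0) [].
have -> : (fun n : nat => h * n%:Z) @^-1` H = setT.
  by apply/seteqP; split=> // n _; exact: subgroup_mul.
exact: infinite_nat.
Qed.

(** This supplies the period [m] in the converse direction: for a nonzero [h] in [H], the absolute
    value of [h] is [h] times its sign. *)
Lemma infinite_subgroup_pos H : subgroup H -> infinite_set H ->
  exists2 m : nat, (0 < m)%N & H m%:Z.
Proof.
move=> sH infH; have [h Hh h0] : exists2 h, H h & h != 0.
  apply: contra_notP infH => noh; apply: (@sub_finite_set _ _ [set 0]) => // h Hh.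
  by apply: contrapT => /eqP h0; apply: noh; exists h.
exists `|h|%N; first by rewrite absz_gt0.
by rewrite abszE normrEsg mulrC; exact: subgroup_mul.
Qed.

End Subgroups.

(** * Null sets and measurable sets of the completed measure *)

Section Completion.
Context (R : realType) (d : measure_display) (X : measurableType d).
Variable mu : {measure set X -> \bar R}.
Implicit Types (A B : set X).

(** Outer measure zero gives, for every [n], a measurable cover of measure at most [1/(n+1)]; the
    intersection of these covers is a measurable null superset. *)
Lemma mu_ext_eq0 A : mu^*%mu A = 0%E <-> mu.-negligible A.
Proof.
split=> [A0|[N [mN N0 AN]]]; last first.
  apply/eqP; rewrite eq_le mu_ext_ge0// andbT -N0 -(measurable_mu_extE mu)//.
  exact: le_outer_measure.
have cover (n : nat) :
    exists U, [/\ measurable U, A `<=` U & (mu U <= (n.+1%:R^-1)%:E)%E].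
  have : (mu^*%mu A < (n.+1%:R^-1)%:E)%E by rewrite A0 lte_fin invr_gt0.
  move=> /ereal_inf_lt[_ [F [mF AF] <-]] /ltW Fn.
  have mU : measurable (\bigcup_k F k) by exact: bigcupT_measurable.
  exists (\bigcup_k F k); split => //.
  by apply: le_trans Fn; exact: measure_sigma_subadditive.
pose U n := projT1 (cid (cover n)).
have UP n : [/\ measurable (U n), A `<=` U n & (mu (U n) <= (n.+1%:R^-1)%:E)%E].
  by rewrite /U; case: cid.
have mU : measurable (\bigcap_n U n).
  by apply: bigcapT_measurable => n; case: (UP n).
exists (\bigcap_n U n); split => //; last by apply: sub_bigcap => n _; case: (UP n).
apply/eqP; rewrite eq_le measure_ge0 andbT; apply/lee_addgt0Pr => e e0.
rewrite add0e.
have [n ne] : exists n : nat, (n.+1%:R^-1 <= e)%R.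
  have [n _ ne] := near_infty_natSinv_lt (PosNum e0).
  by exists n; apply: ltW; exact: ne n (leqnn n).
have [mUn _ Un] := UP n.
apply: le_trans (_ : (mu (U n) <= e%:E)%E).
  by rewrite le_measure ?inE//; exact: bigcap_inf.
by apply: le_trans Un _; rewrite lee_fin.
Qed.

Lemma positiveP A : positive mu A <-> ~ mu.-negligible A.
Proof.
rewrite -mu_ext_eq0 /positive lt0e mu_ext_ge0// andbT.
by split => /eqP.
Qed.

Lemma mu_measurableP A : mu_measurable mu A <->
  exists M, [/\ measurable M, mu.-negligible (A `\` M) & mu.-negligible (M `\` A)].
Proof.
split=> [[M mM [N negN <-]]|[M [mM AM [N [mN N0 MA]]]]].
  exists M; split=> //; first by apply: negligibleS negN => x [[]].
  by rewrite setDUr setDv set0I; exact: negligible_set0.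
(* The generator only adds negligible sets, so [M] must first be shrunk into [A]: deleting the
   measurable null cover [N] of the excess does this. *)
exists (M `\` N); first exact: measurableD.
exists (A `\` (M `\` N)).
  apply: (@negligibleS _ _ _ _ ((A `\` M) `|` N)).
    move=> x [Ax MNx]; have [Nx|nNx] := pselect (N x); first by right.
    by left; split=> // Mx; apply: MNx.
  by apply: negligibleU => //; apply/negligibleP.
apply/seteqP; split=> [x [[Mx nNx]|[]//]|x Ax].
  by apply: contrapT => nAx; apply/nNx/MA.
by have [?|?] := pselect ((M `\` N) x); [left | right].
Qed.

Lemma mu_measurableC A : mu_measurable mu A -> mu_measurable mu (~` A).
Proof.
move=> /mu_measurableP[M [mM AM MA]]; apply/mu_measurableP.
exists (~` M); rewrite !setDE !setCK; split; first exact: measurableC.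
  by rewrite setIC.
by rewrite setIC.
Qed.

Lemma negligible_bigcup_count (I : countType) (P : set I) (F : I -> set X) :
  (forall i, P i -> mu.-negligible (F i)) -> mu.-negligible (\bigcup_(i in P) F i).
Proof.
move=> negF.
(* The family is reindexed by codes in [nat]; numbers that code no index in [P] contribute the empty
   set. *)
pose G n := if unpickle n is Some i then if i \in P then F i else set0 else set0.
apply: (@negligibleS _ _ _ _ (\bigcup_n G n)).
  by move=> x [i Pi Fx]; exists (pickle i) => //; rewrite /G pickleK mem_set.
apply: negligible_bigcup => n; rewrite /G.
case: unpickle => [i|]; last exact: negligible_set0.
by case: ifPn => [/set_mem/negF//|_]; exact: negligible_set0.
Qed.

(** The symmetric difference of two unions lies in the union of the symmetric differences, which is
    a countable union of negligible sets. *)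
Lemma mu_measurable_bigcup (I : countType) (P : set I) (F : I -> set X) :
  (forall i, P i -> mu_measurable mu (F i)) ->
  mu_measurable mu (\bigcup_(i in P) F i).
Proof.
move=> mF.
(* The approximations are chosen for all [i] at once, with [set0] as the default outside [P]. *)
have FM i : exists M, [/\ measurable M, P i -> mu.-negligible (F i `\` M) &
    P i -> mu.-negligible (M `\` F i)].
  have [Pi|nPi] := pselect (P i); last by exists set0.
  by have /mu_measurableP[M []] := mF i Pi; exists M.
pose M i := projT1 (cid (FM i)).
have MP i : [/\ measurable (M i), P i -> mu.-negligible (F i `\` M i) &
    P i -> mu.-negligible (M i `\` F i)] by rewrite /M; case: cid.
apply/mu_measurableP; exists (\bigcup_(i in P) M i); split.
- rewrite bigcup_mkcond; apply: countable_bigcupT_measurable => // i.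
  by case: ifPn => _ //; case: (MP i).
- apply: negligibleS (negligible_bigcup_count (fun i => and3_rec
    (fun _ negFM _ => negFM) (MP i))).
  by move=> x [[i Pi Fx] nMx]; exists i => //; split=> // Mx; apply: nMx; exists i.
- apply: negligibleS (negligible_bigcup_count (fun i => and3_rec
    (fun _ _ negMF => negMF) (MP i))).
  by move=> x [[i Pi Mx] nFx]; exists i => //; split=> // Fx; apply: nFx; exists i.
Qed.

Lemma mu_measurable_bigcap (I : countType) (P : set I) (F : I -> set X) :
  (forall i, P i -> mu_measurable mu (F i)) ->
  mu_measurable mu (\bigcap_(i in P) F i).
Proof.
move=> mF; rewrite -[X in mu_measurable _ X]setCK setC_bigcap.
by apply/mu_measurableC/mu_measurable_bigcup => i /mF; exact: mu_measurableC.
Qed.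

End Completion.

(** * Translates under the action *)

Section IntegerActions.
Context (R : realType) (d : measure_display) (X : measurableType d).
Variables (mu : {measure set X -> \bar R}) (a : int -> X -> X).
Hypotheses (ha : borel_action a) (hmu : mcp mu a).
Implicit Types (A B : set X) (H : set int).

Lemma act0 x : a 0 x = x. Proof. by case: ha. Qed.

Lemma actD m n x : a (m + n) x = a m (a n x). Proof. by case: ha. Qed.

(** Since [a (- n)] inverts [a n], translates are preimages, so they respect measurability and
    Boolean operations. *)
Lemma image_act n A : a n @` A = a (- n) @^-1` A.
Proof.
apply/seteqP; split=> [_ [x Ax <-]|x Ax].
  by rewrite /preimage /= -actD addNr act0.
by exists (a (- n) x) => //; rewrite -actD subrr act0.
Qed.

Lemma image_act0 A : a 0 @` A = A.
Proof. by rewrite image_act oppr0; apply/seteqP; split=> x /=; rewrite act0. Qed.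

Lemma image_actD m n A : a m @` (a n @` A) = a (m + n) @` A.
Proof.
have -> : a (m + n) = a m \o a n by apply/funext => x; rewrite /= actD.
by rewrite image_comp.
Qed.

Lemma image_actI n A B : a n @` (A `&` B) = a n @` A `&` a n @` B.
Proof. by rewrite !image_act preimage_setI. Qed.

Lemma measurable_image_act n A : measurable A -> measurable (a n @` A).
Proof.
move=> mA; rewrite image_act -[X in measurable X]setTI.
by have [_ _ ma] := ha; exact: ma.
Qed.

Lemma negligible_image_act n A : mu.-negligible A -> mu.-negligible (a n @` A).
Proof.
move=> [N [mN N0 AN]]; exists (a n @` N); split.
- exact: measurable_image_act.
- by apply/(hmu n mN).
- exact: image_subset.
Qed.

Lemma positive_image_act n A : positive mu (a n @` A) <-> positive mu A.
Proof.
rewrite !positiveP; split; apply: contra_not => negA; last first.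
  by rewrite -[A]image_act0 -(addNr n) -image_actD; exact: negligible_image_act.
exact: negligible_image_act.
Qed.

Lemma mu_measurable_image_act n A :
  mu_measurable mu A -> mu_measurable mu (a n @` A).
Proof.
move=> /mu_measurableP[M [mM AM MA]]; apply/mu_measurableP.
exists (a n @` M); split; first exact: measurable_image_act.
- have := negligible_image_act n AM; rewrite !image_act.
  by apply: negligibleS.
- have := negligible_image_act n MA; rewrite !image_act.
  by apply: negligibleS.
Qed.

(** * From total ergodicity to chaining *)

Lemma ergodic_positive_meet H A B : subgroup H -> ergodic_on mu a H ->
    mu_measurable mu A -> positive mu A -> positive mu B ->
  exists2 n, H n & positive mu (a n @` A `&` B).
Proof.
move=> /subgroupP[H0 HB] ergH mA /positiveP posA /positiveP posB.
(* The saturation of [A] under [H] is invariant and contains [A], so ergodicity makes it conull. *)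
pose U := \bigcup_(n in H) a n @` A.
have mU : mu_measurable mu U.
  by apply: mu_measurable_bigcup => n _; exact: mu_measurable_image_act.
have subU m : H m -> a m @` U `<=` U.
  move=> Hm; rewrite image_bigcup => x [n Hn]; rewrite image_actD => Ax.
  exists (m + n) => //; rewrite -[n]opprK; apply: (HB) => //.
  by rewrite -sub0r; exact: HB.
have invU : invariant_set a H U.
  move=> m Hm; apply/seteqP; split; first exact: subU.
  (* For the reverse inclusion, [U] is the translate by [m] of its translate by [- m], which lies in
     [U]. *)
  rewrite -{1}[U]image_act0 -(subrr m) -image_actD; apply: image_subset.
  by apply: subU; rewrite -sub0r; exact: HB.
have [negU|negCU] := ergH U mU invU.
  by case: posA; apply: negligibleS negU => x Ax; exists 0 => //; rewrite image_act0.
apply: contrapT => noH; apply: posB.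
(* If all the overlaps were negligible, [B] would be covered by the null complement of [U] and
   countably many null sets. *)
apply: (@negligibleS _ _ _ _ (~` U `|` \bigcup_(n in H) (a n @` A `&` B))).
  move=> x Bx; have [[n Hn Ax]|nUx] := pselect (U x); last by left.
  by right; exists n.
apply: negligibleU => //; apply: negligible_bigcup_count => n Hn.
by apply: contrapT => /positiveP posn; apply: noH; exists n.
Qed.

(** The end points of chains starting at [0], with the length forgotten; the inductive form allows
    induction along a chain. *)
Inductive reach A : int -> Prop :=
| reach0 : reach A 0
| reachS m n : reach A m -> positive mu (a m @` A `&` a n @` A) -> reach A n.

Lemma reachP A n : reach A n -> exists l (g : nat -> int), [/\ g 0%N = 0,
  forall i, (i < l)%N -> positive mu (a (g i) @` A `&` a (g i.+1) @` A) & g l = n].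
Proof.
elim=> {n} [|m n _ [l [g [g0 gS gl]]] mn]; first by exists 0%N, (fun=> 0).
(* The new end point fills every index beyond [l], of which only [l.+1] is ever read. *)
exists l.+1, (fun i => if (i <= l)%N then g i else n); split => //; last first.
  by rewrite ltnn.
move=> i; rewrite ltnS => il; rewrite il; case: ltngtP il => // [il|->] _.
  exact: gS.
by rewrite gl.
Qed.

(** A chain from [0] to [n] can be reflected and shifted into one from [m] to [m - n]: a link
    between [n] and [n'], translated by [m - n - n'], becomes a link between [m - n'] and
    [m - n]. *)
Lemma subgroup_reach A : subgroup (reach A).
Proof.
apply/subgroupP; split=> [|m n rm rn]; first exact: reach0.
elim: rn m rm => {n} [m|n n' _ IHn nn' m rm]; first by rewrite subr0.
apply: (reachS (IHn m rm)).
suff -> : a (m - n) @` A `&` a (m - n') @` A =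
    a (m - n - n') @` (a n @` A `&` a n' @` A).
  by apply/positive_image_act.
rewrite image_actI !image_actD setIC subrK.
by rewrite addrAC subrK.
Qed.

Lemma totally_ergodic_chaining : totally_ergodic mu a -> chaining mu a.
Proof.
move=> erg A B mA _ posA posB.
have [m rm m0] : exists2 m, reach A m & m != 0.
  pose H2 := [set n | (2 %| n)%Z].
  have sH2 : subgroup H2.
    by apply/subgroupP; split=> [|m n]; [exact: dvdz0 | exact: rpredB].
  have infH2 : infinite_set H2 by apply: (@infinite_subgroup _ 2).
  have [|n H2n posn] :=
      ergodic_positive_meet sH2 (erg _ sH2 infH2) mA posA (B := a 1 @` A).
    by apply/positive_image_act.
  (* As [n] is even, [1 - n] is nonzero; the overlap of the translates by [n] and [1] is the
     translate by [n] of the overlap of those by [0] and [1 - n]. *)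
  exists (1 - n); last by apply: contraTneq H2n => /subr0_eq <-.
  apply: (reachS (reach0 A)).
  by rewrite -(positive_image_act n) image_actI !image_actD addr0 addrC subrK.
have infr := infinite_subgroup (subgroup_reach A) rm m0.
have [n /reachP[l [g [g0 gS <-]]] posn] := ergodic_positive_meet
  (subgroup_reach A) (erg _ (subgroup_reach A) infr) mA posA posB.
by exists l, g.
Qed.

(** * From chaining to total ergodicity *)

Lemma finite_fiber_positive (S : finType) (f : X -> S) :
  positive mu setT -> exists x, positive mu (f @^-1` [set f x]).
Proof.
move=> /positiveP posT; apply: contrapT => nof; apply: posT.
rewrite (_ : setT = \bigcup_(s in setT) f @^-1` [set s]); last first.
  by apply/seteqP; split=> // x _; exists (f x).
apply: negligible_bigcup_count => s _; apply: contrapT => negs.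
(* A fibre that is not negligible is nonempty, so [s] is a value of [f]. *)
have [x fx] : f @^-1` [set s] !=set0.
  by apply/set0P/eqP => f0; apply: negs; rewrite f0; exact: negligible_set0.
by apply: nof; exists x; rewrite fx; apply/positiveP.
Qed.

(* The class of [x] in the partition generated by all the translates of [B]. *)
Let atom B x := [set y | forall i, B (a i y) <-> B (a i x)].

(** The class is a countable intersection of translates of [B] and of their complements, selected by
    the itinerary of [x]. *)
Lemma mu_measurable_atom B x : mu_measurable mu B -> mu_measurable mu (atom B x).
Proof.
move=> mB.
have -> : atom B x = \bigcap_(i in [set: int])
    (if `[< B (a i x) >] then a (- i) @` B else ~` (a (- i) @` B)).
  apply/seteqP; split=> [y By i _|y By i].
    by case: asboolP => Bx; rewrite image_act opprK /preimage /setC /= By.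
  have := By i I; rewrite image_act opprK.
  by case: asboolP => Bx /=; rewrite /preimage /setC /=; tauto.
apply: mu_measurable_bigcap => i _.
by case: ifP => _; [|apply: mu_measurableC]; exact: mu_measurable_image_act.
Qed.

(** Translating two points by the same integer shifts both itineraries equally, so translates of a
    class are again classes: equal as soon as they share a point. *)
Lemma image_atom_eq B x m n y : (a m @` atom B x) y -> (a n @` atom B x) y ->
  a m @` atom B x = a n @` atom B x.
Proof.
rewrite !image_act /preimage /=.
suff sub p q : atom B x (a (- p) y) -> atom B x (a (- q) y) ->
    [set z | atom B x (a (- p) z)] `<=` [set z | atom B x (a (- q) z)].
  by move=> ym yn; apply/seteqP; split; exact: sub.
move=> yp yq z zp i.
(* Time [i] seen from [a (- q) w] is time [i - q + p] seen from [a (- p) w]. *)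
have shift w : a i (a (- q) w) = a (i - q + p) (a (- p) w).
  by rewrite -!actD addrK.
by rewrite shift zp -yp -shift yq.
Qed.

(** An itinerary of period [m] is determined by its values at [0, ..., m - 1]. There are finitely
    many such patterns, so one of them occurs on a set of positive measure, and that set lies in a
    single class. *)
Lemma periodic_atom_positive B (m : nat) : positive mu setT -> (0 < m)%N ->
    (forall k x, B (a (m%:Z * k) x) <-> B x) ->
  exists x, positive mu (atom B x).
Proof.
move=> posT m0 perB.
have [x /positiveP posx] :=
  finite_fiber_positive (fun x => [ffun r : 'I_m => `[< B (a r%:Z x) >]]) posT.
exists x; apply/positiveP; apply: contra_not posx; apply: negligibleS.
move=> y /= /ffunP fyx i.
have m0' : m%:Z != 0 by rewrite eqz_nat -lt0n.
have rm : (`|(i %% m)%Z| < m)%N by rewrite -ltz_nat gez0_abs ?modz_ge0 ?ltz_pmod.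
have := fyx (Ordinal rm); rewrite !ffunE /= gez0_abs ?modz_ge0// => Byx.
rewrite (divz_eq i m) mulrC !(actD (m%:Z * _)) !perB.
exact: asbool_eq_equiv.
Qed.

Lemma chaining_totally_ergodic : chaining mu a -> totally_ergodic mu a.
Proof.
move=> chain H sH infH B mB invB; apply: contrapT => /not_orP[posB posCB].
have [m m0 Hm] := infinite_subgroup_pos sH infH.
have perB k x : B (a (m%:Z * k) x) <-> B x.
  rewrite -{2}(invB (m%:Z * - k)); last exact: subgroup_mul.
  by rewrite image_act mulrN opprK.
have [|x posA] := periodic_atom_positive _ m0 perB.
  by apply/positiveP; apply: contra_not posB; exact: negligibleS.
have mA := mu_measurable_atom x mB.
(* Time [0] of the itinerary puts the whole class inside [B] or inside its complement, so a conull
   class would make [B] conull or null. *)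
have posCA : positive mu (~` atom B x).
  apply/positiveP => negCA; have [Bx|nBx] := pselect (B x).
    apply: posCB; apply: negligibleS negCA => y nBy /(_ 0).
    by rewrite !act0 => -[_ /(_ Bx)].
  apply: posB; apply: negligibleS negCA => y By /(_ 0).
  by rewrite !act0 => -[/(_ By)].
have [l [g [g0 gS]]] := chain _ _ mA (mu_measurableC mA) posA posCA.
(* Consecutive translates overlap in positive measure, hence share a point and coincide; the chain
   never leaves the class and cannot meet its complement. *)
have gA i : (i <= l)%N -> a (g i) @` atom B x = atom B x.
  elim: i => [_|i IHi il]; first by rewrite g0 image_act0.
  rewrite -[RHS](IHi (ltnW il)).
  have /positiveP posi := gS i il.
  have [y [yi ySi]] : a (g i) @` atom B x `&` a (g i.+1) @` atom B x !=set0.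
    by apply/set0P/eqP => i0; apply: posi; rewrite i0; exact: negligible_set0.
  exact: image_atom_eq ySi yi.
by rewrite gA// setICr => /positiveP; apply; exact: negligible_set0.
Qed.

End IntegerActions.

Theorem proposition4p9 (R : realType) (d : measure_display)
    (X : measurableType d) (mu : probability X R) (a : int -> X -> X)
    (hX : standard_borel R X) (ha : borel_action a) (hmu : mcp mu a) :
  chaining mu a <-> totally_ergodic mu a.
Proof.
split.
- exact: chaining_totally_ergodic.
- exact: totally_ergodic_chaining.
Qed.
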